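(* Let $(X,\Omega)$ be a measurable space, let $A$ be a $\sigma$-Dedekind complete vector lattice algebra with a $\sigma$-monotone continuous multiplication, and let $\mu\colon\Omega\to A^+$ be a finite measure. The following are equivalent: (1) $I_\mu\colon\mathcal L^1(X,\Omega,\mu;\mathbb R)\to A$ is a vector lattice homomorphism; (2) $I_\mu\colon\mathcal B(X,\Omega;\mathbb R)\to A$ is a vector lattice homomorphism; (3) $\mu(\Delta_1\cap\Delta_2)=\mu(\Delta_1)\wedge\mu(\Delta_2)$ in $A$ for $\Delta_1,\Delta_2\in\Omega$; (4) $\mu(\Delta_1\cup\Delta_2)=\mu(\Delta_1)\vee\mu(\Delta_2)$ in $A$ for $\Delta_1,\Delta_2\in\Omega$. The following are equivalent: (5) $\mathcal L^1(X,\Omega,\mu;\mathbb R)$ is a commutative algebra, and $I_\mu\colon\mathcal L^1(X,\Omega,\mu;\mathbb R)\to A$ is an algebra homomorphism; (6) $I_\mu\colon\mathcal B(X,\Omega;\mathbb R)\to A$ is an algebra homomorphism; (7) $\mu$ is a spectral measure; (8) $\mu(\Delta)^2=\mu(\Delta)$ for $\Delta\in\Omega$ and $\mu(\Delta_1)\mu(\Delta_2)=\mu(\Delta_2)\mu(\Delta_1)$ for $\Delta_1,\Delta_2\in\Omega$. Suppose that at least one of the following is satisfied: (a) $A$ has a positive identity element $e$ and $\mu(X)\le e$; (b) $A$ is a semiprime $f$-algebra. Then each of the equivalent parts (5)--(8) implies each of the equivalent parts (1)--(4).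
   Context: All vector spaces are over $\mathbb R$; $\mathbb R^+=[0,\infty)$; vector lattices are supposed to be Archimedean. $x_n\uparrow x$ means that $(x_n)$ is an increasing sequence with supremum $x$. A vector lattice is $\sigma$-Dedekind complete if every non-empty countable subset that is bounded above has a supremum. A vector lattice algebra $A$ is an associative algebra that is also a vector lattice with $ab\in A^+$ for $a,b\in A^+$; no identity element is assumed. Its multiplication is $\sigma$-monotone continuous if, for all sequences in $A^+$ with $a_n\uparrow a\in A^+$, one has $ba_n\uparrow ba$ and $a_nb\uparrow ab$ for all $b\in A^+$. $A$ is an $f$-algebra if, for $x,y,z\in A^+$, $x\wedge y=0$ implies $(zx)\wedge y=(xz)\wedge y=0$; an $f$-algebra is semiprime if $0$ is its only nilpotent element. A finite measure $\mu\colon\Omega\to A^+$ is a map with $\mu(\emptyset)=0$ and $\mu(\bigcup_n\Delta_n)=\bigvee_{N}\sum_{n=1}^N\mu(\Delta_n)$ in $A$ for every pairwise disjoint sequence in the $\sigma$-algebra $\Omega$; it is a spectral measure if $\mu(\Delta_1\cap\Delta_2)=\mu(\Delta_1)\mu(\Delta_2)$ for all $\Delta_1,\Delta_2\in\Omega$. Order integral: for $\varphi=\sum_{i=1}^n r_i\chi_{\Delta_i}$ with $r_i\in\mathbb R^+$ and disjoint $\Delta_i\in\Omega$, $\int_X^{o}\varphi\,d\mu=\sum r_i\mu(\Delta_i)$; for measurable $f\colon X\to[0,\infty]$, $\int_X^{o}f\,d\mu=\bigvee_n\int_X^{o}\varphi_n\,d\mu$ in $A^+\cup\{\infty\}$ ($\infty$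 adjoined as largest element) for any sequence of such $\varphi_n\uparrow f$ pointwise (independent of the choice). $\mathcal L^1(X,\Omega,\mu;\mathbb R)$ consists of the measurable $f\colon X\to\mathbb R$ with $\int_X^{o}|f|\,d\mu\in A$, and then $I_\mu(f)=\int^{o}_X f\,d\mu=\int^{o}_Xf^+\,d\mu-\int^{o}_Xf^-\,d\mu$. $\mathcal B(X,\Omega;\mathbb R)$ is the space of bounded measurable functions. Function spaces carry pointwise operations and order; ''$\mathcal L^1$ is a commutative algebra'' means under pointwise multiplication. *)

(* Defs.v *)
From HB Require Import structures.
From mathcomp Require Import all_boot all_order all_algebra.
From mathcomp Require Import all_classical all_reals all_analysis.

Set Implicit Arguments.
Unset Strict Implicit.
Unset Printing Implicit Defensive.

Import Order.TTheory GRing.Theory Num.Theory.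

Local Open Scope classical_set_scope.
Local Open Scope ring_scope.

(* Joining Order.Lattice with GRing.Zmodule is rejected by the hierarchy
   (realDomainType would have to inherit from the join), so the lattice
   operations are added to porderZmodType with the axioms lexI and leUx of
   the Order library. *)
HB.mixin Record isVectorLattice (R : realType) V
    of GRing.Lmodule R V & Num.POrderedZmodule V := {
  vl_leD : forall x y z : V, x <= y -> x + z <= y + z;
  vl_scale_ge0 : forall (r : R) (x : V), 0 <= r -> 0 <= x -> 0 <= r *: x;
  vmeet : V -> V -> V;
  vjoin : V -> V -> V;
  vl_lexI : forall x y z : V, (x <= vmeet y z) = (x <= y) && (x <= z);
  vl_leUx : forall x y z : V, (vjoin x y <= z) = (x <= z) && (y <= z);
  vl_archimedean : forall x y : V,
    0 <= x -> (forall n : nat, x *+ n <= y) -> x = 0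
}.

#[short(type="vectorLatticeType")]
HB.structure Definition VectorLattice (R : realType) :=
  {V of GRing.Lmodule R V & Num.POrderedZmodule V & isVectorLattice R V}.

(* The multiplication is that of semigroupType, written (x * y)%g: the
   multiplication of pzRingType would come with an identity element. *)
HB.mixin Record isVLAlgebra (R : realType) A
    of VectorLattice R A & Semigroup A := {
  vla_mulDl : forall x y z : A, ((x + y) * z)%g = (x * z)%g + (y * z)%g;
  vla_mulDr : forall x y z : A, (x * (y + z))%g = (x * y)%g + (x * z)%g;
  vla_scaleAl : forall (r : R) (x y : A), r *: (x * y)%g = ((r *: x) * y)%g;
  vla_scaleAr : forall (r : R) (x y : A), r *: (x * y)%g = (x * (r *: y))%g;
  vla_mul_ge0 : forall x y : A, 0 <= x -> 0 <= y -> 0 <= (x * y)%g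
}.

#[short(type="vlAlgType")]
HB.structure Definition VLAlgebra (R : realType) :=
  {A of VectorLattice R A & Semigroup A & isVLAlgebra R A}.

Section order.
Context {disp : Order.disp_t} {T : porderType disp}.

Definition increases_to (u : nat -> T) (a : T) : Prop :=
  nondecreasing_seq u /\ isLub (range u) a.

Definition sigma_dedekind_complete : Prop :=
  forall S : set T, countable S -> has_sup S -> exists m : T, isLub S m.

End order.
Arguments sigma_dedekind_complete {disp} T.

Section algebra.
Context {R : realType} (A : vlAlgType R).

Definition sigma_monotone_continuous_mul : Prop :=
  forall (u : nat -> A) (a : A),
    (forall n, 0 <= u n) -> 0 <= a -> increases_to u a ->
    forall b : A, 0 <= b ->
      increases_to (fun n => (b * u n)%g) (b * a)%g /\
      increases_to (fun n => (u n * b)%g) (a * b)%g.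

Definition is_identity (e : A) : Prop :=
  forall x : A, (e * x)%g = x /\ (x * e)%g = x.

Definition is_f_algebra : Prop :=
  forall x y z : A, 0 <= x -> 0 <= y -> 0 <= z -> vmeet x y = 0 ->
    vmeet (z * x)%g y = 0 /\ vmeet (x * z)%g y = 0.

(* iter n (mulg x) x is the power x^(n+1). *)
Definition nilpotent_elt (x : A) : Prop :=
  exists n : nat, iter n (fun y : A => (x * y)%g) x = 0.

Definition is_semiprime : Prop := forall x : A, nilpotent_elt x -> x = 0.

End algebra.

(* The sigma-algebra is a plain set of sets satisfying sigma_algebra rather
   than a measurableType, because the latter is never empty. Measures are total
   functions on sets whose values outside Omega are irrelevant. *)
Section measure.
Context {R : realType} {X : Type} {A : vlAlgType R}.
Variables (Omega : set (set X)) (mu : set X -> A).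

Definition finite_A_measure : Prop :=
  [/\ forall D, Omega D -> 0 <= mu D,
      mu set0 = 0 &
      forall F : nat -> set X,
        (forall n, Omega (F n)) -> trivIset [set: nat] F ->
        isLub (range (fun N => \sum_(n < N.+1) mu (F n)))
              (mu (\bigcup_n F n))].

Definition spectral : Prop := forall D1 D2, Omega D1 -> Omega D2 ->
  mu (D1 `&` D2) = (mu D1 * mu D2)%g.

Definition idempotent_commuting : Prop :=
  (forall D, Omega D -> (mu D * mu D)%g = mu D) /\
  (forall D1 D2, Omega D1 -> Omega D2 ->
     (mu D1 * mu D2)%g = (mu D2 * mu D1)%g).

Definition preserves_meets : Prop := forall D1 D2, Omega D1 -> Omega D2 ->
  mu (D1 `&` D2) = vmeet (mu D1) (mu D2).

Definition preserves_joins : Prop := forall D1 D2, Omega D1 -> Omega D2 ->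
  mu (D1 `|` D2) = vjoin (mu D1) (mu D2).

End measure.

(* A presentation sum_(i < n) r_i 1_(D_i) of a simple function, with r_i >= 0
   and pairwise disjoint D_i in Omega. *)
Record simple_fun (R : realType) (X : Type) (Omega : set (set X)) := SimpleFun {
  sf_size : nat;
  sf_coef : 'I_sf_size -> R;
  sf_set : 'I_sf_size -> set X;
  sf_coef_ge0 : forall i, 0 <= sf_coef i;
  sf_set_in : forall i, Omega (sf_set i);
  sf_disjoint : trivIset [set: 'I_sf_size] sf_set
}.
Arguments sf_coef {R X Omega} s i.
Arguments sf_set {R X Omega} s i _.

Section integral.
Context {R : realType} {X : Type} {A : vlAlgType R}.
Variables (Omega : set (set X)) (mu : set X -> A).
Implicit Types (s : simple_fun R Omega) (f : X -> R).

Definition sf_val s : X -> R := fun x => \sum_i sf_coef s i * \1_(sf_set s i) x.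

Definition sf_integral s : A := \sum_i sf_coef s i *: mu (sf_set s i).

(* a is a finite order integral of f : X -> [0, +oo]; by the independence of
   the approximating sequence, there is at most one such a. *)
Definition is_order_integral (f : X -> \bar R) (a : A) : Prop :=
  exists phi : nat -> simple_fun R Omega,
    (forall x, increases_to (fun n => (sf_val (phi n) x)%:E) (f x)) /\
    increases_to (fun n => sf_integral (phi n)) a.

(* The value lives in \bar A, with +oo playing the part of the largest element
   adjoined to the positive cone of A: for a measurable f, an approximating
   sequence exists, and when its integrals have no supremum in A they are
   unbounded by sigma-Dedekind completeness. *)
Definition order_integral (f : X -> \bar R) : \bar A :=
  if `[< exists a, is_order_integral f a >]
  then (xget 0 [set a | is_order_integral f a])%:E else +oo%E.

Definition measurable_real f : Prop :=
  forall B : set R, measurable B -> Omega (f @^-1` B).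

Definition L1 : set (X -> R) := [set f | measurable_real f /\
  exists a : A, order_integral (fun x => `|f x|%:E) = a%:E].

Definition bounded_measurable : set (X -> R) :=
  [set f | measurable_real f /\ exists M : R, forall x, `|f x| <= M].

Definition I_mu f : A :=
  fine (order_integral (fun x => (f^\+ x)%:E)) -
  fine (order_integral (fun x => (f^\- x)%:E)).

End integral.

(* Spaces of real functions carry the pointwise operations and order, so a
   subspace is a vector lattice (an algebra) for these when it is closed under
   them. *)
Section homomorphisms.
Context {R : realType} {X : Type} {A : vlAlgType R}.
Variables (L : set (X -> R)) (T : (X -> R) -> A).

Definition linear_subspace : Prop :=
  L (fun=> 0) /\ forall (r : R) f g, L f -> L g -> L (fun x => r * f x + g x).

Definition function_lattice : Prop := linear_subspace /\
  forall f g, L f -> L g -> L (f \min g) /\ L (f \max g).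

Definition function_algebra : Prop := linear_subspace /\
  forall f g, L f -> L g -> L (f \* g).

Definition linear_on : Prop := forall (r : R) f g, L f -> L g ->
  T (fun x => r * f x + g x) = r *: T f + T g.

Definition vector_lattice_hom : Prop :=
  [/\ function_lattice, linear_on &
      forall f g, L f -> L g ->
        T (f \min g) = vmeet (T f) (T g) /\ T (f \max g) = vjoin (T f) (T g)].

Definition algebra_hom : Prop :=
  [/\ function_algebra, linear_on &
      forall f g, L f -> L g -> T (f \* g) = (T f * T g)%g].

End homomorphisms.

(* Main.v *)
(* A simple function presented by an arbitrary list of pairs (c, D) has integral
   sum c mu(D), and this depends monotonically on the function it presents.  If
   s is a simple function and t_n >= 0 increase to f >= s, then for every e > 0
   the sets E_n = {s <= t_n + e} increase to X, and the integral of s exceeds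
   that of t_n by at most e mu(X) + M mu(~ E_n); the Archimedean property then
   shows that the order integral of f is the supremum of the integrals of all
   simple functions below f.

   If mu maps intersections to meets, functions p, q >= 0 with pq = 0 have
   disjoint integrals, since simple functions below p and q are bounded by
   multiples of indicators of disjoint sets; apply this to the positive and
   negative parts of f - g.  If mu is spectral, the integral is multiplicative
   on simple functions, hence on L1 by monotone continuity of the product.
   If the values of mu are idempotent, disjoint sets have measures a, b >= 0
   with (a + b)^2 = a + b, so that ab = 0.  For 0 <= x <= a, b this gives
   x^2 <= ab = 0, and x = (e - a) x + a x <= (e - a) a + ab = 0 when a <= e for
   an identity e. *)

Require Import Defs.
From HB Require Import structures.
From mathcomp Require Import all_boot all_order all_algebra.
From mathcomp Require Import all_classical all_reals all_analysis.
From mathcomp Require Import measurable_realfun ring lra.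

Set Implicit Arguments.
Unset Strict Implicit.
Unset Printing Implicit Defensive.

Import Order.TTheory GRing.Theory Num.Theory.

Local Open Scope classical_set_scope.
Local Open Scope ring_scope.

(** * Order and lattice arithmetic in an Archimedean vector lattice *)

Section vector_lattice.
Context {R : realType} {V : vectorLatticeType R}.
Implicit Types x y z t : V.

Lemma vl_lerD2r z x y : (x + z <= y + z) = (x <= y).
Proof.
apply/idP/idP => [|]; last exact: vl_leD.
by move=> /(@vl_leD _ _ _ _ (- z)); rewrite !addrK.
Qed.

Lemma vl_lerD2l z x y : (z + x <= z + y) = (x <= y).
Proof. by rewrite ![z + _]addrC vl_lerD2r. Qed.

Lemma vl_lerBrDr x y z : (x <= y - z) = (x + z <= y).
Proof. by rewrite -[LHS](vl_lerD2r z) subrK. Qed.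

Lemma vl_lerBlDr x y z : (x - z <= y) = (x <= y + z).
Proof. by rewrite -[LHS](vl_lerD2r z) subrK. Qed.

Lemma vl_subr_ge0 x y : (0 <= y - x) = (x <= y).
Proof. by rewrite vl_lerBrDr add0r. Qed.

Lemma vl_lerD x y z t : x <= y -> z <= t -> x + z <= y + t.
Proof.
by move=> xy zt; apply: (@le_trans _ _ (y + z)); rewrite ?vl_lerD2r ?vl_lerD2l.
Qed.

Lemma vl_lerZ (r : R) x y : 0 <= r -> x <= y -> r *: x <= r *: y.
Proof.
by move=> r0 xy; rewrite -vl_subr_ge0 -scalerBr vl_scale_ge0 // vl_subr_ge0.
Qed.

Lemma vl_lerZr (r s : R) x : 0 <= x -> r <= s -> r *: x <= s *: x.
Proof.
by move=> x0 rs; rewrite -vl_subr_ge0 -scalerBl vl_scale_ge0 // subr_ge0.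
Qed.

Lemma vmeet_lel x y : vmeet x y <= x.
Proof. by have := lexx (vmeet x y); rewrite vl_lexI => /andP[]. Qed.

Lemma vmeet_ler x y : vmeet x y <= y.
Proof. by have := lexx (vmeet x y); rewrite vl_lexI => /andP[]. Qed.

Lemma vjoin_gel x y : x <= vjoin x y.
Proof. by have := lexx (vjoin x y); rewrite vl_leUx => /andP[]. Qed.

Lemma vjoin_ger x y : y <= vjoin x y.
Proof. by have := lexx (vjoin x y); rewrite vl_leUx => /andP[]. Qed.

Lemma vmeetC x y : vmeet x y = vmeet y x.
Proof.
by apply/eqP; rewrite eq_le !vl_lexI !vmeet_lel !vmeet_ler.
Qed.

Lemma vmeetDr z x y : vmeet (x + z) (y + z) = vmeet x y + z.
Proof.
apply/eqP; rewrite eq_le; apply/andP; split.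
  by rewrite -vl_lerBlDr vl_lexI !vl_lerBlDr vmeet_lel vmeet_ler.
by rewrite vl_lexI !vl_lerD2r vmeet_lel vmeet_ler.
Qed.

Lemma vmeetDl z x y : vmeet (z + x) (z + y) = z + vmeet x y.
Proof. by rewrite ![z + _]addrC vmeetDr. Qed.

(** The reflection sending u to x + y - u exchanges x and y and reverses the order, so it turns the
    greatest lower bound of the pair into the least upper bound. *)
Lemma vjoinE x y : vjoin x y = x + y - vmeet x y.
Proof.
apply/eqP; rewrite eq_le; apply/andP; split.
  by rewrite vl_leUx !vl_lerBrDr vl_lerD2l vmeet_ler addrC vl_lerD2r vmeet_lel.
rewrite vl_lerBlDr [leRHS]addrC -vl_lerBlDr vl_lexI !vl_lerBlDr.
by rewrite vl_lerD2l [x + y]addrC vl_lerD2l vjoin_gel vjoin_ger.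
Qed.

(** The nontrivial half of the distributive law for a meet with a supremum. Since s + b is the sum
    of the meet and the join of s and b, every s in S lies below c + [vjoin a b] - b; hence so does
    a, and the join cancels against a + b. *)
Lemma isLub_vmeet_le (S : set V) a b c : isLub S a ->
  (forall s, S s -> vmeet s b <= c) -> vmeet a b <= c.
Proof.
move=> [Sa aS] Sc.
have /aS : ubound S (c + vjoin a b - b).
  move=> s Ss; rewrite vl_lerBrDr.
  have -> : s + b = vmeet s b + vjoin s b by rewrite vjoinE [RHS]addrC subrK.
  apply: vl_lerD; first exact: Sc.
  by rewrite vl_leUx vjoin_ger andbT (le_trans (Sa _ Ss))// vjoin_gel.
rewrite vl_lerBrDr -[a + b](subrK (vmeet a b)) -vjoinE addrC.
by rewrite vl_lerD2r.
Qed.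

(** The Archimedean axiom asks for a positive element, so it is applied to [vjoin x 0]; taking e =
    1/(n+1) bounds its multiples by y. *)
Lemma vl_archimedean_le0 x y : 0 <= y ->
  (forall e : R, 0 < e -> x <= e *: y) -> x <= 0.
Proof.
move=> y0 xy; rewrite -(@vl_archimedean _ _ (vjoin x 0) y); first exact: vjoin_gel.
  exact: vjoin_ger.
case=> [|n]; first by rewrite mulr0n.
have -> : y = n.+1%:R^-1 *: y *+ n.+1.
  by rewrite -scaler_nat scalerA divff ?scale1r// pnatr_eq0.
rewrite -!(scaler_nat n.+1 (_ : V)) vl_lerZ// vl_leUx vl_scale_ge0// andbT.
by apply: xy; rewrite invr_gt0.
Qed.

End vector_lattice.

(** * Real functions measurable with respect to [Omega] *)

Section measurability.
Context {R : realType} {X : Type} {Omega : set (set X)}.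
Hypothesis hOmega : sigma_algebra [set: X] Omega.
Implicit Types f g : X -> R.

Lemma salg0 : Omega set0. Proof. by case: hOmega. Qed.

Lemma salgC D : Omega D -> Omega (~` D).
Proof. by case: hOmega => _ + _ => /[apply]; rewrite setTD. Qed.

Lemma salgT : Omega setT.
Proof. by rewrite -setC0; apply/salgC/salg0. Qed.

Lemma salgU D E : Omega D -> Omega E -> Omega (D `|` E).
Proof.
move=> OD OE; rewrite -bigcup2E; case: hOmega => O0 _; apply=> n.
by rewrite /bigcup2; case: ifP => // _; case: ifP.
Qed.

Lemma salgI D E : Omega D -> Omega E -> Omega (D `&` E).
Proof.
move=> OD OE; rewrite -[_ `&` _]setCK setCI.
by apply/salgC/salgU; apply: salgC.
Qed.

Lemma salgD D E : Omega D -> Omega E -> Omega (D `\` E).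
Proof. by move=> OD OE; apply/salgI => //; apply: salgC. Qed.

(* A nonempty X with the sigma-algebra Omega is a measurableType; over an empty
   X every map is measurable. *)
Lemma measurable_real_op2 (op : R -> R -> R) f g :
  (forall d (T : measurableType d) (u v : T -> R),
     measurable_fun setT u -> measurable_fun setT v ->
     measurable_fun setT (fun x => op (u x) (v x))) ->
  measurable_real Omega f -> measurable_real Omega g ->
  measurable_real Omega (fun x => op (f x) (g x)).
Proof.
move=> mop mf mg.
have [[x0]|X0] := pselect (inhabited X); last first.
  move=> B mB; rewrite (_ : _ @^-1` _ = set0); first exact: salg0.
  by rewrite -subset0 => x; exfalso; apply: X0.
pose T : pointedType :=
  HB.pack X (gen_eqMixin X) (gen_choiceMixin X) (isPointed.Build X x0).
have mE (h : X -> R) : measurable_real Omega h <->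
    measurable_fun setT (h : @g_sigma_algebraType T Omega -> R).
  split=> [mh _ B mB|mh B mB].
    by rewrite setTI; apply: sub_sigma_algebra; apply: mh.
  by have := mh measurableT B mB; rewrite setTI /measurable/= sigma_algebra_id.
by apply/mE; apply: mop; apply/mE.
Qed.

Lemma measurable_real_cst (r : R) : measurable_real Omega (fun=> r).
Proof.
move=> B mB; rewrite /preimage.
have [rB|rB] := pselect (B r).
  by rewrite (_ : [set _ | _] = setT); [exact: salgT|by apply/seteqP; split].
by rewrite (_ : [set _ | _] = set0); [exact: salg0|by apply/seteqP; split].
Qed.

Lemma measurable_real_indic D : Omega D -> measurable_real Omega (\1_D : X -> R).
Proof.
move=> OD B _.
rewrite preimage_indic.
have OC := salgC OD; have O0 := salg0; have OT := salgT.
by case: ifP => _; case: ifP.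
Qed.

Lemma measurable_realD f g :
  measurable_real Omega f -> measurable_real Omega g ->
  measurable_real Omega (fun x => f x + g x).
Proof. by apply: measurable_real_op2 => d T u v; apply: measurable_funD. Qed.

Lemma measurable_realM f g :
  measurable_real Omega f -> measurable_real Omega g ->
  measurable_real Omega (fun x => f x * g x).
Proof. by apply: measurable_real_op2 => d T u v; apply: measurable_funM. Qed.

Lemma measurable_real_min f g :
  measurable_real Omega f -> measurable_real Omega g ->
  measurable_real Omega (f \min g).
Proof.
apply: (measurable_real_op2 (op := Num.min)) => d T u v.
exact: measurable_minr.
Qed.

Lemma measurable_real_max f g :
  measurable_real Omega f -> measurable_real Omega g ->
  measurable_real Omega (f \max g).
Proof.
apply: (measurable_real_op2 (op := Num.max)) => d T u v.
exact: measurable_maxr.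
Qed.

Lemma measurable_realZ (r : R) f : measurable_real Omega f ->
  measurable_real Omega (fun x => r * f x).
Proof.
by move=> mf; apply: measurable_realM => //; apply: measurable_real_cst.
Qed.

Lemma measurable_realN f : measurable_real Omega f ->
  measurable_real Omega (fun x => - f x).
Proof.
move=> /(measurable_realZ (-1)); congr measurable_real.
by apply/funext => x; rewrite mulN1r.
Qed.

Lemma measurable_funrpos_real f : measurable_real Omega f ->
  measurable_real Omega f^\+.
Proof.
by move=> mf; apply: measurable_real_max => //; apply: measurable_real_cst.
Qed.

Lemma measurable_funrneg_real f : measurable_real Omega f ->
  measurable_real Omega f^\-.
Proof.
move=> mf; apply: measurable_real_max; last exact: measurable_real_cst.
exact: measurable_realN.
Qed.

End measurability.

(** * Finite additivity and continuity from below of the measure *)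

Section measure.
Context {R : realType} {X : Type} {Omega : set (set X)} {A : vlAlgType R}.
Context {mu : set X -> A}.
Hypothesis hOmega : sigma_algebra [set: X] Omega.
Hypothesis hmu : finite_A_measure Omega mu.

Lemma A_measure_ge0 D : Omega D -> 0 <= mu D.
Proof. by case: hmu => + _ _; apply. Qed.

Lemma A_measure0 : mu set0 = 0. Proof. by case: hmu. Qed.

Lemma A_measureU D E : Omega D -> Omega E -> D `&` E = set0 ->
  mu (D `|` E) = mu D + mu E.
Proof.
move=> OD OE DE0; have [_ mu0 sadd] := hmu.
have [||ub lb] := sadd (bigcup2 D E).
- by case=> [|[|n]]//; exact: (salg0 hOmega).
- by apply/trivIsetP => -[|[|i]] [|[|j]]//= _ _ _;
    rewrite ?setI0 ?set0I// setIC.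
rewrite bigcup2E in ub lb.
have sumE n : \sum_(i < n.+2) mu (bigcup2 D E i) = mu D + mu E.
  by rewrite !big_ord_recl big1 ?addr0// => i _; rewrite /bigcup2/= mu0.
apply/eqP; rewrite eq_le; apply/andP; split.
  (* The partial sum at N = 0 is [mu D] alone; all later ones equal [mu D + mu E]. *)
  apply: lb => _ [[|n] _ <-]; last by rewrite sumE.
  by rewrite big_ord_recl big_ord0 vl_lerD2l A_measure_ge0.
by apply: ub; exists 1 => //; rewrite sumE.
Qed.

Lemma A_measure_split E D : Omega D -> Omega E ->
  mu D = mu (D `&` E) + mu (D `\` E).
Proof.
move=> OD OE; rewrite -A_measureU ?setUIDK//; first exact: salgI.
- exact: salgD.
- by rewrite setDE setIACA setICr setI0.
Qed.

Lemma A_measureC D : Omega D -> mu (~` D) = mu setT - mu D.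
Proof.
move=> OD; rewrite (A_measure_split (salgT hOmega) OD) setTI setTD.
by rewrite addrC addKr.
Qed.

Lemma le_A_measure D E : Omega D -> Omega E -> D `<=` E -> mu D <= mu E.
Proof.
move=> OD OE DE; rewrite (A_measure_split OE OD) setIidr//.
by rewrite -[leLHS]addr0 vl_lerD2l A_measure_ge0//; apply: salgD.
Qed.

(** The successive differences of the sets E n are disjoint with union X, and their partial sums
    telescope to [mu (E N)]; countable additivity then makes [mu setT] the least upper bound. *)
Lemma A_measure_cont_below (E : nat -> set X) b :
  (forall n, Omega (E n)) -> nondecreasing_seq E -> \bigcup_n E n = setT ->
  (forall n, mu (E n) <= b) -> mu setT <= b.
Proof.
move=> OE ndE ET Eb.
have OF n : Omega (seqD E n).
  by case: n => [|n]; rewrite /seqD//; apply: salgD.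
have [_ _ /(_ (seqD E) OF (trivIset_seqD ndE))] := hmu.
rewrite eq_bigcup_seqD ET => -[_]; apply => _ [N _ <-].
rewrite (_ : \sum_(_ < _) _ = mu (E N))//.
elim: N => [|N IH]; first by rewrite big_ord_recl big_ord0 addr0.
rewrite big_ord_recr IH /= (A_measure_split (OE N.+1) (OE N)) setIidr//.
by apply/subsetPset; apply: ndE.
Qed.

End measure.

(** * Step functions presented by lists *)

Section step.
Context {R : realType} {X : Type}.
Implicit Types s t : seq (R * set X).

(** The sets may overlap and the coefficients may be negative. Thus concatenation is addition and
    scaling by -1 is negation, and two presentations never have to be refined to common disjoint
    sets. *)
Definition step_val s : X -> R := fun x => \sum_(p <- s) p.1 * \1_(p.2) x.

Definition step_int {A : vlAlgType R} (mu : set X -> A) s : A :=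
  \sum_(p <- s) p.1 *: mu p.2.

Definition step_in (Omega : set (set X)) s : Prop :=
  {in s, forall p, Omega p.2}.

Definition step_scale (r : R) s := [seq (r * p.1, p.2) | p <- s].

Definition step_mul s t :=
  [seq (p.1 * q.1, p.2 `&` q.2) | p <- s, q <- t].

Definition step_of_simple (Omega : set (set X)) (phi : simple_fun R Omega) :=
  [seq (sf_coef phi i, sf_set phi i) | i <- index_enum 'I_(sf_size phi)].

Lemma step_val_cat s t x : step_val (s ++ t) x = step_val s x + step_val t x.
Proof. exact: big_cat. Qed.

Lemma step_val_cons p s x : step_val (p :: s) x = p.1 * \1_(p.2) x + step_val s x.
Proof. exact: big_cons. Qed.

Lemma step_val_scale r s x : step_val (step_scale r s) x = r * step_val s x.
Proof.
by rewrite /step_val big_map mulr_sumr; apply: eq_bigr => p _; rewrite mulrA.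
Qed.

Lemma step_val_mul s t x :
  step_val (step_mul s t) x = step_val s x * step_val t x.
Proof.
rewrite /step_val big_allpairs_dep mulr_suml; apply: eq_bigr => p _.
rewrite mulr_sumr; apply: eq_bigr => q _.
by rewrite indicI /= mulrACA.
Qed.

Lemma step_val_simple Omega (phi : simple_fun R Omega) :
  step_val (step_of_simple phi) = sf_val phi.
Proof. by apply/funext => x; rewrite /step_val big_map. Qed.

Lemma step_val_bounded s : exists2 M : R, 0 < M & forall x, `|step_val s x| <= M.
Proof.
(* The summand 1 makes the bound strictly positive, so that it can be inverted later. *)
exists (1 + \sum_(p <- s) `|p.1|) => [|x].
  by rewrite ltr_pwDl// sumr_ge0.
apply: (@le_trans _ _ (\sum_(p <- s) `|p.1|)); last by rewrite lerDr.
apply: (le_trans (ler_norm_sum _ _ _)); apply: ler_sum => p _.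
rewrite normrM -[leRHS]mulr1 ler_wpM2l// indicE.
by case: (_ \in _); rewrite ?normr1 ?normr0.
Qed.

Lemma step_in_cat Omega s t : step_in Omega s -> step_in Omega t ->
  step_in Omega (s ++ t).
Proof. by move=> Os Ot p; rewrite mem_cat => /orP[/Os|/Ot]. Qed.

Lemma step_in_scale Omega r s : step_in Omega s -> step_in Omega (step_scale r s).
Proof. by move=> Os _ /mapP[p /Os Op ->]. Qed.

Lemma step_in_simple Omega (phi : simple_fun R Omega) :
  step_in Omega (step_of_simple phi).
Proof. by move=> _ /mapP[i _ ->]; apply: sf_set_in. Qed.

Context {A : vlAlgType R} (mu : set X -> A).

Lemma step_int_cat s t : step_int mu (s ++ t) = step_int mu s + step_int mu t.
Proof. exact: big_cat. Qed.

Lemma step_int_scale r s : step_int mu (step_scale r s) = r *: step_int mu s.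
Proof.
rewrite /step_int big_map scaler_sumr; apply: eq_bigr => p _.
by rewrite scalerA.
Qed.

Lemma step_int_simple Omega (phi : simple_fun R Omega) :
  step_int mu (step_of_simple phi) = sf_integral mu phi.
Proof. exact: big_map. Qed.

End step.

(** * Monotonicity of the integral of step functions, also along increasing sequences *)

Section step_integral.
Context {R : realType} {X : Type} {Omega : set (set X)} {A : vlAlgType R}.
Context {mu : set X -> A}.
Hypothesis hOmega : sigma_algebra [set: X] Omega.
Hypothesis hmu : finite_A_measure Omega mu.
Implicit Types s t : seq (R * set X).

Lemma step_in_mul s t : step_in Omega s -> step_in Omega t ->
  step_in Omega (step_mul s t).
Proof.
move=> Os Ot _ /allpairsP[[p q]/= [/Os Op /Ot Oq ->]].
exact: salgI.
Qed.

Lemma measurable_step_val s : step_in Omega s ->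
  measurable_real Omega (step_val s).
Proof.
elim: s => [_|p s IH Os].
  rewrite (_ : step_val _ = fun=> 0); first exact: measurable_real_cst.
  by apply/funext => x; rewrite /step_val big_nil.
rewrite (_ : step_val _ = fun x => p.1 * \1_(p.2) x + step_val s x); last first.
  by apply/funext => x; rewrite step_val_cons.
apply: measurable_realD => //.
  apply: measurable_realZ => //; apply: measurable_real_indic => //.
  by apply: Os; rewrite mem_head.
by apply: IH => q qs; apply: Os; rewrite in_cons qs orbT.
Qed.

(* Induction on s, splitting D along the first set of s. *)
Lemma step_int_on_ge s D c : step_in Omega s -> Omega D ->
  (forall x, D x -> c <= step_val s x) ->
  c *: mu D <= \sum_(p <- s) p.1 *: mu (p.2 `&` D).
Proof.
elim: s D c => [D c _ OD cD|p s IH D c Os OD cD].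
  (* For the empty list, a point of D forces c <= 0, and an empty D has measure 0. *)
  rewrite big_nil; have [->|/set0P[x Dx]] := eqVneq D set0.
    by rewrite (A_measure0 hmu) scaler0.
  rewrite -(scale0r (mu D)) vl_lerZr ?(A_measure_ge0 hmu)//.
  by have := cD _ Dx; rewrite /step_val big_nil.
have Op : Omega p.2 by apply: Os; rewrite mem_head.
have {}Os : step_in Omega s by move=> q qs; apply: Os; rewrite in_cons qs orbT.
have ODp := salgI hOmega OD Op; have ODp' := salgD hOmega OD Op.
rewrite big_cons.
have -> : \sum_(q <- s) q.1 *: mu (q.2 `&` D) =
    \sum_(q <- s) q.1 *: mu (q.2 `&` (D `&` p.2)) +
    \sum_(q <- s) q.1 *: mu (q.2 `&` (D `\` p.2)).
  rewrite -big_split/=; rewrite big_seq [RHS]big_seq; apply: eq_bigr => q qs.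
  rewrite -scalerDr (A_measure_split hOmega hmu (E := p.2))//.
    by rewrite setIA setIDA.
  by apply: salgI => //; apply: Os.
rewrite (A_measure_split hOmega hmu OD Op) scalerDr addrA.
(* Off [p.2] the first term vanishes and c remains the lower bound; on [p.2] it is the constant
   [p.1], and the remaining list is bounded below by c - [p.1]. *)
apply: vl_lerD; last first.
  apply: IH => // x [Dx px]; have := cD x Dx.
  by rewrite step_val_cons indicE memNset// mulr0 add0r.
rewrite [p.2 `&` D]setIC addrC -vl_lerBlDr -scalerBl.
apply: IH => // x [Dx px]; have := cD x Dx.
by rewrite step_val_cons indicE mem_set// mulr1 -lerBlDl.
Qed.

(** The difference t - s is again presented by a list, and it is bounded below by 0 on all of X. *)
Lemma step_int_le s t : step_in Omega s -> step_in Omega t ->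
  (forall x, step_val s x <= step_val t x) -> step_int mu s <= step_int mu t.
Proof.
move=> Os Ot st; have := @step_int_on_ge (t ++ step_scale (-1) s) setT 0.
rewrite scale0r; under eq_bigr do rewrite setIT.
rewrite -[X in _ <= X]/(step_int mu _) step_int_cat step_int_scale scaleN1r.
rewrite vl_subr_ge0; apply; last 1 first.
- by move=> x _; rewrite step_val_cat step_val_scale mulN1r subr_ge0.
- by apply: step_in_cat => //; apply: step_in_scale.
- exact: salgT.
Qed.

Lemma step_int_ge0 s : step_in Omega s -> (forall x, 0 <= step_val s x) ->
  0 <= step_int mu s.
Proof.
move=> Os s0; have := @step_int_le [::] s.
rewrite /step_int big_nil; apply => // x.
by rewrite [step_val [::] x]big_nil.
Qed.

(* With E n = [set x | s x <= t n x + e], s is at most t n + e + M 1_(~ E n) for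
   a bound M of s, and the sets E n increase to X. *)
Lemma step_int_le_limit s (t : nat -> seq (R * set X)) b :
  step_in Omega s -> (forall n, step_in Omega (t n)) ->
  (forall n x, 0 <= step_val (t n) x) ->
  (forall x, nondecreasing_seq (fun n => step_val (t n) x)) ->
  (forall x e, 0 < e -> exists n, step_val s x <= step_val (t n) x + e) ->
  (forall n, step_int mu (t n) <= b) -> step_int mu s <= b.
Proof.
move=> Os Ot t0 ndt st tb.
have OT := salgT hOmega.
suff : step_int mu s - b <= 0 by rewrite vl_lerBlDr add0r.
apply: (vl_archimedean_le0 (A_measure_ge0 hmu OT)) => e e0.
have [M M0 sM] := step_val_bounded s.
pose E n := [set x | step_val s x <= step_val (t n) x + e].
have OE n : Omega (E n).
  have -> : E n = (fun x => step_val (t n ++ step_scale (-1) s) x + e)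
      @^-1` `[0, +oo[%classic.
    apply/seteqP; split=> x; rewrite /E/= in_itv/= andbT step_val_cat;
      rewrite step_val_scale; lra.
  apply: measurable_realD => //; last exact: measurable_real_cst.
  apply: measurable_step_val; apply: step_in_cat => //.
  exact: step_in_scale.
(* The right-hand side is free of n, so it suffices to bound [mu (E n)] by it and pass to X by
   continuity from below. After multiplication by M the two terms M mu(X) cancel, leaving the
   integral of s below b + e mu(X). *)
suff /(vl_lerZ (ltW M0)) : mu setT <=
    M^-1 *: (b + e *: mu setT + M *: mu setT - step_int mu s).
  rewrite scalerA divff ?gt_eqF// scale1r vl_lerBrDr addrC vl_lerD2r.
  by rewrite vl_lerBlDr addrC.
apply: (A_measure_cont_below hOmega hmu OE) => [m n mn||n].
- apply/subsetPset => x; rewrite /E/= => /le_trans; apply.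
  by rewrite lerD2r ndt.
- by apply/seteqP; split => // x _; have [n xn] := st x e e0; exists n.
have : step_int mu s <= step_int mu (t n ++ [:: (e, setT); (M, ~` E n)]).
  apply: step_int_le => //.
    apply: step_in_cat => // p; rewrite !inE => /orP[]/eqP ->//=.
    exact: salgC.
  move=> x; rewrite step_val_cat !step_val_cons /step_val big_nil/= !indicE.
  rewrite in_setT in_setC mulr1 addr0 addrA.
  have [/set_mem xE|xE] := boolP (x \in E n).
    by rewrite mulr0 addr0.
  rewrite mulr1 (le_trans (ler_norm _))// (le_trans (sM x))// lerDr.
  by rewrite addr_ge0 ?t0// ltW.
rewrite step_int_cat [X in _ <= _ + X]/step_int !big_cons big_nil/= addr0.
rewrite (A_measureC hOmega hmu (OE n)) => sle.
have : M *: mu (E n) <= b + e *: mu setT + M *: mu setT - step_int mu s.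
  rewrite vl_lerBrDr addrC -vl_lerBrDr -addrA -scalerBr (le_trans sle)//.
  by rewrite -addrA vl_lerD2r.
move=> /(vl_lerZ (r := M^-1)); rewrite scalerA mulVf ?gt_eqF// scale1r.
by apply; rewrite invr_ge0 ltW.
Qed.

End step_integral.

(** * Dyadic approximation of a nonnegative real *)

Section dyadic.
Context {R : realType}.

Definition dyadic_level (n k : nat) : set R :=
  `[k%:R / 2 ^+ n, k.+1%:R / 2 ^+ n[%classic.

Lemma mem_dyadic_level n k y : 0 <= y ->
  (y \in dyadic_level n k) = (Num.truncn (y * 2 ^+ n) == k).
Proof.
move=> y0; have y20 : 0 <= y * 2 ^+ n by rewrite mulr_ge0// exprn_ge0.
rewrite mem_setE in_itv/= ler_pdivrMr ?exprn_gt0// ltr_pdivlMr ?exprn_gt0//.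
by rewrite eqn_leq truncn_le_nat truncn_ge_nat// andbC.
Qed.

Lemma measurable_dyadic_level n k : measurable (dyadic_level n k).
Proof. exact: measurable_itv. Qed.

Lemma trivIset_dyadic_level n N :
  trivIset [set: 'I_N] (fun k => dyadic_level n k).
Proof.
move=> i j _ _ [y [yi yj]]; apply/val_inj/eqP; rewrite /= eq_sym.
have y0 : 0 <= y.
  move: yi; rewrite /dyadic_level/= in_itv/= => /andP[+ _]; apply: le_trans.
  by rewrite divr_ge0// exprn_ge0.
move/mem_set: yi; rewrite mem_dyadic_level// => /eqP <-.
by move/mem_set: yj; rewrite mem_dyadic_level// eq_sym.
Qed.

(** The value is 0, not n, once y >= n. Only the levels with k < n 2^n are then needed, and for
    fixed y the sequence still increases, as it is 0 until n exceeds y. *)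
Definition dyadic_floor (n : nat) (y : R) : R :=
  if y < n%:R then (Num.truncn (y * 2 ^+ n))%:R / 2 ^+ n else 0.

(** At most one term of the sum survives, the one whose index is the integer part of y 2^n; that
    index is in range exactly when y < n. *)
Lemma dyadic_floorE n y : 0 <= y ->
  \sum_(k < n * 2 ^ n) k%:R / 2 ^+ n * \1_(dyadic_level n k) y =
  dyadic_floor n y.
Proof.
move=> y0; have y20 : 0 <= y * 2 ^+ n by rewrite mulr_ge0// exprn_ge0.
have -> : \sum_(k < n * 2 ^ n) k%:R / 2 ^+ n * \1_(dyadic_level n k) y =
    \sum_(k < n * 2 ^ n | Num.truncn (y * 2 ^+ n) == k) k%:R / 2 ^+ n :> R.
  rewrite [RHS]big_mkcond; apply: eq_bigr => k _.
  by rewrite indicE mem_dyadic_level//; case: ifP; rewrite ?mulr1 ?mulr0.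
rewrite /dyadic_floor -(ltr_pM2r (exprn_gt0 n (@ltr0Sn R 1))) -natrX -natrM.
rewrite -truncn_lt_nat natrX//; case: ifPn => [tn|].
  by rewrite (big_pred1 (Ordinal tn)).
by move=> tn; rewrite big1// => k /eqP tk; move: tn; rewrite tk ltn_ord.
Qed.

Lemma dyadic_floor_ge0 n y : 0 <= dyadic_floor n y.
Proof.
by rewrite /dyadic_floor; case: ifP => // _; rewrite divr_ge0// exprn_ge0.
Qed.

Lemma dyadic_floor_le n y : 0 <= y -> dyadic_floor n y <= y.
Proof.
move=> y0; have y20 : 0 <= y * 2 ^+ n by rewrite mulr_ge0// exprn_ge0.
rewrite /dyadic_floor; case: ifP => // _.
by rewrite ler_pdivrMr ?exprn_gt0//; case/andP: (truncn_itv y20).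
Qed.

Lemma dyadic_floor_nd y : 0 <= y -> nondecreasing_seq (dyadic_floor ^~ y).
Proof.
move=> y0; apply/nondecreasing_seqP => n.
have y20 m : 0 <= y * 2 ^+ m by rewrite mulr_ge0// exprn_ge0.
rewrite {1}/dyadic_floor; case: ifP => [yn|_]; last exact: dyadic_floor_ge0.
rewrite /dyadic_floor (lt_le_trans yn) ?ler_nat//.
rewrite [in leRHS]exprS [in leRHS]invfM [leRHS]mulrA.
rewrite ler_wpM2r ?invr_ge0 ?exprn_ge0//.
(* Twice the integer part of y 2^n is an integer below y 2^(n+1), hence at most the integer part of
   the latter. *)
rewrite ler_pdivlMr// -natrM ler_nat truncn_ge_nat.
  rewrite natrM mulrCA mulrC ler_wpM2l//.
  by case/andP: (truncn_itv (y20 n)).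
by rewrite mulrCA mulr_ge0.
Qed.

Lemma dyadic_floor_near y e : 0 <= y -> 0 < e ->
  exists n, y <= dyadic_floor n y + e.
Proof.
move=> y0 e0.
(* This n exceeds y, so that y is not cut off to 0, and exceeds 1/e, so that the mesh 2^-n is at
   most e. *)
pose n := (Num.truncn (y + e^-1)).+1.
have yn : y + e^-1 < n%:R.
  have /truncn_itv/andP[] // : 0 <= y + e^-1.
  by rewrite addr_ge0// invr_ge0 ltW.
have en : e^-1 < n%:R by apply: le_lt_trans yn; rewrite lerDr.
exists n; have y20 : 0 <= y * 2 ^+ n by rewrite mulr_ge0// exprn_ge0.
rewrite /dyadic_floor (le_lt_trans _ yn) ?lerDl ?invr_ge0 ?(ltW e0)//.
have /andP[_ yt] := truncn_itv y20.
have : y < (Num.truncn (y * 2 ^+ n)).+1%:R / 2 ^+ n.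
  by rewrite ltr_pdivlMr ?exprn_gt0.
rewrite -natr1 mulrDl mul1r => /ltW /le_trans; apply.
rewrite lerD2l -[leRHS]invrK lef_pV2 ?posrE ?exprn_gt0 ?invr_gt0//.
by rewrite (le_trans (ltW en))// -natrX ler_nat ltnW// ltn_expl.
Qed.

End dyadic.

(** * The order integral as the supremum of lower sums *)

Section order_integral.
Context {R : realType} {X : Type} {Omega : set (set X)} {A : vlAlgType R}.
Context {mu : set X -> A}.
Hypothesis hOmega : sigma_algebra [set: X] Omega.
Hypothesis hmu : finite_A_measure Omega mu.
Implicit Types (f g : X -> R) (s : seq (R * set X)) (a b : A).

(** The supremum of this set refers to no approximating sequence, which makes it an intrinsic form
    of the order integral. *)
Definition lower_sums f : set A :=
  [set a | exists s, [/\ step_in Omega s, forall x, step_val s x <= f x &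
                         a = step_int mu s]].

(** Pointwise increase to a real-valued f, with the supremum in epsilon form and with lists in place
    of disjoint presentations, so that sums and products of approximating sequences are again of
    this kind. *)
Definition approximates (t : nat -> seq (R * set X)) f : Prop :=
  [/\ forall n, step_in Omega (t n),
      forall n x, 0 <= step_val (t n) x <= f x,
      forall x, nondecreasing_seq (fun n => step_val (t n) x) &
      forall x e, 0 < e -> exists n, f x <= step_val (t n) x + e].

Lemma approximates_nd t f : approximates t f ->
  nondecreasing_seq (fun n => step_int mu (t n)).
Proof.
by case=> Ot _ ndt _ m n mn; apply: (step_int_le hOmega hmu) => // x; apply: ndt.
Qed.

Lemma approximates_ubound t f b : approximates t f ->
  (forall n, step_int mu (t n) <= b) -> ubound (lower_sums f) b.
Proof.
move=> [Ot tf ndt ft] tb _ [s [Os sf ->]].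
apply: (step_int_le_limit hOmega hmu (t := t)) => //.
- by move=> n x; case/andP: (tf n x).
- by move=> x e e0; have [n xn] := ft x e e0; exists n; rewrite (le_trans (sf x)).
Qed.

(** Both sets have the same upper bounds, hence the same suprema. This is the independence of the
    order integral from the approximating sequence. *)
Lemma approximates_isLub t f a : approximates t f ->
  isLub (range (fun n => step_int mu (t n))) a <-> isLub (lower_sums f) a.
Proof.
move=> tf.
have ubE b : ubound (range (fun n => step_int mu (t n))) b <->
    ubound (lower_sums f) b.
  split=> [tb|fb]; last first.
    move=> _ [n _ <-]; apply: fb; exists (t n); case: tf => Ot tf _ _.
    split=> //.
    by move=> x; case/andP: (tf n x).
  by apply: (approximates_ubound tf) => n; apply: tb; exists n.
by split=> -[/ubE ub lub]; split=> // b /ubE; apply: lub.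
Qed.

Lemma increases_to_EFin (u : nat -> R) (r : R) :
  increases_to (fun n => (u n)%:E) r%:E <->
  [/\ nondecreasing_seq u, forall n, u n <= r &
      forall e, 0 < e -> exists n, r <= u n + e].
Proof.
split=> [[ndu [ub lub]]|[ndu ur ru]].
  split=> [m n mn|n|e e0].
  - by have := ndu _ _ mn; rewrite lee_fin.
  - by rewrite -lee_fin; apply: ub; exists n.
  - apply: contrapT => /forallNP ne.
    (* If no term came within e of r, then r - e would be a smaller upper bound. *)
    suff /lub : ubound (range (fun n => (u n)%:E)) (r - e)%:E.
      by rewrite lee_fin lerBrDr gerDl leNgt e0.
    move=> _ [n _ <-]; rewrite lee_fin lerBrDr ltW// ltNge.
    by apply/negP; apply: ne.
split=> [m n mn|]; first by rewrite lee_fin ndu.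
split=> [_ [n _ <-]|b ub]; first by rewrite lee_fin.
apply/lee_addgt0Pr => e e0; have [n rn] := ru e e0.
apply: (@le_trans _ _ (u n + e)%:E); rewrite ?lee_fin// EFinD leeD2r//.
by apply: ub; exists n.
Qed.

Lemma approximates_simple (phi : nat -> simple_fun R Omega) f :
  (forall x, increases_to (fun n => (sf_val (phi n) x)%:E) (f x)%:E) <->
  approximates (fun n => step_of_simple (phi n)) f.
Proof.
have sE n x : step_val (step_of_simple (phi n)) x = sf_val (phi n) x.
  by rewrite step_val_simple.
split=> [phif|[_ phif ndphi fphi] x].
  split=> [n|n x|x m n mn|x e e0] /=.
  - exact: step_in_simple.
  - rewrite sE sumr_ge0/= => [|i _]; last first.
      by rewrite mulr_ge0 ?sf_coef_ge0// indicE ler0n.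
    by have /increases_to_EFin[_ + _] := phif x; apply.
  - by rewrite !sE; have /increases_to_EFin[+ _ _] := phif x; apply.
  - have /increases_to_EFin[_ _ /(_ _ e0)[n fn]] := phif x.
    by exists n; rewrite sE.
apply/increases_to_EFin; split=> [m n mn|n|e e0].
- by rewrite -!sE; apply: ndphi.
- by rewrite -sE; case/andP: (phif n x).
- by have [n fn] := fphi x e e0; exists n; rewrite -sE.
Qed.

Section dyadic_simple.
Variables (f : X -> R) (mf : measurable_real Omega f) (n : nat).

Let coef (k : 'I_(n * 2 ^ n)) : R := k%:R / 2 ^+ n.
Let level (k : 'I_(n * 2 ^ n)) : set X := f @^-1` dyadic_level n k.

Let coef_ge0 k : 0 <= coef k.
Proof. by rewrite divr_ge0// exprn_ge0. Qed.

Let level_in k : Omega (level k).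
Proof. exact: mf (measurable_dyadic_level n k). Qed.

Let trivIset_level : trivIset [set: 'I_(n * 2 ^ n)] level.
Proof.
move=> i j _ _ [x [xi xj]]; apply: (@trivIset_dyadic_level _ n) => //.
by exists (f x).
Qed.

Definition dyadic_simple := SimpleFun coef_ge0 level_in trivIset_level.

Lemma dyadic_simple_val x : 0 <= f x ->
  sf_val dyadic_simple x = dyadic_floor n (f x).
Proof. by move=> fx0; rewrite -dyadic_floorE. Qed.

End dyadic_simple.

Lemma dyadic_simple_increases_to f (mf : measurable_real Omega f) :
  (forall x, 0 <= f x) ->
  forall x, increases_to (fun n => (sf_val (dyadic_simple mf n) x)%:E) (f x)%:E.
Proof.
move=> f0 x; apply/increases_to_EFin; split=> [m n mn|n|e e0].
- by rewrite !dyadic_simple_val// dyadic_floor_nd.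
- by rewrite dyadic_simple_val// dyadic_floor_le.
- have [n fn] := dyadic_floor_near (f0 x) e0.
  by exists n; rewrite dyadic_simple_val.
Qed.

Lemma approximates_exists f : measurable_real Omega f ->
  (forall x, 0 <= f x) -> exists t, approximates t f.
Proof.
move=> mf f0; exists (fun n => step_of_simple (dyadic_simple mf n)).
exact/approximates_simple/dyadic_simple_increases_to.
Qed.

(** The integrals along any witnessing sequence have the same supremum as the lower sums;
    conversely, the dyadic simple functions supply a witness. *)
Lemma is_order_integralP f a : measurable_real Omega f -> (forall x, 0 <= f x) ->
  is_order_integral Omega mu (EFin \o f) a <-> isLub (lower_sums f) a.
Proof.
move=> mf f0; split=> [[phi [phif [_ phia]]]|fa].
  have /approximates_simple phit := phif.
  apply/(approximates_isLub _ phit).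
  by under eq_fun do rewrite /= step_int_simple.
have phif := dyadic_simple_increases_to mf f0.
exists (dyadic_simple mf); split; first exact: phif.
move/approximates_simple : phif => phit.
under eq_fun do rewrite -step_int_simple.
by split; [exact: approximates_nd phit|exact/(approximates_isLub _ phit)].
Qed.

(** The working form of a finite order integral: a relation, which avoids the choice and the
    infinite value in [order_integral]. *)
Definition has_integral f a : Prop :=
  [/\ measurable_real Omega f, forall x, 0 <= f x & isLub (lower_sums f) a].

Lemma has_integral_uniq f a b : has_integral f a -> has_integral f b -> a = b.
Proof.
move=> [_ _ [ua la]] [_ _ [ub lb]]; apply/eqP; rewrite eq_le.
by rewrite la ?lb.
Qed.

Lemma order_integral_has_integral f a : has_integral f a ->
  order_integral Omega mu (EFin \o f) = a%:E.
Proof.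
move=> fa; have [mf f0 fla] := fa; have foa := (is_order_integralP a mf f0).2 fla.
rewrite /order_integral ifT; last by apply/asboolP; exists a.
(* The element b picked by [xget] is some order integral of f, and uniqueness identifies it with
   a. *)
case: xgetP => [b _ /is_order_integralP|/(_ a)//] fb; congr EFin.
by apply: (@has_integral_uniq f) => //; split=> //; apply: fb.
Qed.

Lemma has_integral_order_integral f a : measurable_real Omega f ->
  (forall x, 0 <= f x) -> order_integral Omega mu (EFin \o f) = a%:E ->
  has_integral f a.
Proof.
rewrite /order_integral => mf f0; case: asboolP => // -[b fb] [<-].
split=> //; apply/is_order_integralP => //.
by case: xgetP => [c _//|/(_ b)].
Qed.

End order_integral.

(** * Additivity, homogeneity and domination for integrals of nonnegative functions *)

Section has_integral_theory.
Context {R : realType} {X : Type} {Omega : set (set X)} {A : vlAlgType R}.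
Context {mu : set X -> A}.
Hypothesis hOmega : sigma_algebra [set: X] Omega.
Hypothesis hmu : finite_A_measure Omega mu.
Implicit Types (f g : X -> R) (s : seq (R * set X)) (a b : A).
Local Notation has_integral := (@has_integral R X Omega A mu).
Local Notation lower_sums := (@lower_sums R X Omega A mu).
Local Notation approximates := (@approximates R X Omega).

Lemma lower_sums0 f : (forall x, 0 <= f x) -> lower_sums f 0.
Proof.
by move=> f0; exists [::]; split=> // [x|]; rewrite /step_val /step_int big_nil.
Qed.

Lemma has_integral_ge0 f a : has_integral f a -> 0 <= a.
Proof. by case=> _ f0 [ub _]; apply: ub; apply: lower_sums0. Qed.

Lemma has_integral_step s : step_in Omega s -> (forall x, 0 <= step_val s x) ->
  has_integral (step_val s) (step_int mu s).
Proof.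
move=> Os s0; split=> //; first exact: measurable_step_val.
split=> [_ [t [Ot ts ->]]|b]; first exact: (step_int_le hOmega hmu).
by apply; exists s.
Qed.

Lemma approximates_int_le t f a n : has_integral f a -> approximates t f ->
  step_int mu (t n) <= a.
Proof.
move=> [_ _ [ub _]] [Ot tf _ _]; apply: ub; exists (t n); split => // x.
by case/andP: (tf n x).
Qed.

Lemma approximates_int_ge0 t f n : approximates t f -> 0 <= step_int mu (t n).
Proof.
move=> [Ot tf _ _]; apply: (step_int_ge0 hOmega hmu) => // x.
by case/andP: (tf n x).
Qed.

Lemma approximatesD t u f g : approximates t f -> approximates u g ->
  approximates (fun n => t n ++ u n) (fun x => f x + g x).
Proof.
move=> [Ot tf ndt ft] [Ou ug ndu gu]; split=> [n|n x|x m n mn|x e e0].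
- exact: step_in_cat.
- have /andP[t0 tfx] := tf n x; have /andP[u0 ugx] := ug n x.
  by rewrite step_val_cat addr_ge0//= lerD.
- by rewrite !step_val_cat lerD// ?ndt// ndu.
- have e20 : 0 < e / 2 by rewrite divr_gt0.
  have [m fm] := ft x _ e20; have [n gn] := gu x _ e20.
  exists (maxn m n); rewrite step_val_cat.
  have := ndt x _ _ (leq_maxl m n); have := ndu x _ _ (leq_maxr m n).
  lra.
Qed.

Lemma approximatesM t u f g : approximates t f -> approximates u g ->
  approximates (fun n => step_mul (t n) (u n)) (fun x => f x * g x).
Proof.
move=> [Ot tf ndt ft] [Ou ug ndu gu]; split=> [n|n x|x m n mn|x e e0].
- exact: (step_in_mul hOmega).
- have /andP[t0 tfx] := tf n x; have /andP[u0 ugx] := ug n x.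
  by rewrite step_val_mul mulr_ge0//= ler_pM.
- have /andP[t0 _] := tf m x; have /andP[u0 _] := ug m x.
  by rewrite !step_val_mul ler_pM// ?ndt// ndu.
- have f0 : 0 <= f x by have /andP[] := tf 0%N x; apply: le_trans.
  have g0 : 0 <= g x by have /andP[] := ug 0%N x; apply: le_trans.
  (* If a and b are within d of f x and g x, then f g - a b = (f - a) g + a (g - b) is at most d (f
     + g), hence at most e. The 1 keeps the denominator positive where f and g vanish. *)
  pose d := e / (f x + g x + 1).
  have d0 : 0 < d by rewrite divr_gt0// ltr_wpDl// addr_ge0.
  have dE : d * (f x + g x + 1) = e.
    by rewrite divfK// gt_eqF// ltr_wpDl// addr_ge0.
  have [m fm] := ft x _ d0; have [n gn] := gu x _ d0.
  exists (maxn m n); rewrite step_val_mul.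
  have tm := ndt x _ _ (leq_maxl m n); have un := ndu x _ _ (leq_maxr m n).
  have /andP[t0 tl] := tf (maxn m n) x; have /andP[u0 ul] := ug (maxn m n) x.
  have : f x <= step_val (t (maxn m n)) x + d by lra.
  have : g x <= step_val (u (maxn m n)) x + d by lra.
  move: t0 tl u0 ul; set a := step_val _ x; set b := step_val _ x.
  move=> a0 af b0 bg gb fa.
  have : f x * g x - a * b = (f x - a) * g x + a * (g x - b) by ring.
  have : (f x - a) * g x <= d * g x by rewrite ler_wpM2r// lerBlDl.
  have : a * (g x - b) <= f x * d.
    by rewrite ler_pM// ?subr_ge0// lerBlDl.
  by move=> h1 h2 h3; rewrite -dE; nra.
Qed.

(** The sums of two approximating sequences show that a + b is an upper bound. It is the least one
    because a lower sum of f plus a lower sum of g is a lower sum of f + g, and the two suprema can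
    be taken one after the other. *)
Lemma has_integralD f g a b : has_integral f a -> has_integral g b ->
  has_integral (fun x => f x + g x) (a + b).
Proof.
move=> fa gb; have [mf f0 [_ lubf]] := fa; have [mg g0 [_ lubg]] := gb.
have [t tf] := approximates_exists mf f0.
have [u ug] := approximates_exists mg g0.
split; [exact: measurable_realD|by move=> x; rewrite addr_ge0|split].
  apply: (approximates_ubound hOmega hmu (approximatesD tf ug)) => n.
  rewrite step_int_cat vl_lerD//; first exact: approximates_int_le fa tf.
  exact: approximates_int_le gb ug.
move=> c ubc; rewrite -vl_lerBrDr; apply: lubf => _ [s [Os sf ->]].
rewrite vl_lerBrDr addrC -vl_lerBrDr; apply: lubg => _ [s' [Os' sg ->]].
rewrite vl_lerBrDr addrC -step_int_cat; apply: ubc; exists (s ++ s').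
by split => // [|x]; [exact: step_in_cat|rewrite step_val_cat lerD].
Qed.

Lemma has_integral_cst0 : has_integral (fun=> 0) 0.
Proof.
have := @has_integral_step [::]; rewrite /step_int big_nil.
rewrite (_ : step_val [::] = fun=> 0); first exact.
by apply/funext => x; rewrite /step_val big_nil.
Qed.

Lemma has_integralZ r f a : 0 <= r -> has_integral f a ->
  has_integral (fun x => r * f x) (r *: a).
Proof.
rewrite le_eqVlt => /predU1P[<- _|r0 [mf f0 [ub lub]]].
  rewrite scale0r; under eq_fun do rewrite mul0r.
  exact: has_integral_cst0.
split; [exact: measurable_realZ|by move=> x; rewrite mulr_ge0// ltW|split].
  move=> _ [s [Os sf ->]].
  rewrite -[step_int _ s]scale1r -(divff (lt0r_neq0 r0)) -scalerA.
  apply: (vl_lerZ (ltW r0)); apply: ub; exists (step_scale r^-1 s).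
  split; [exact: step_in_scale| |by rewrite step_int_scale].
  by move=> x; rewrite step_val_scale ler_pdivrMl.
move=> c ubc; rewrite -[c]scale1r -(divff (lt0r_neq0 r0)) -scalerA.
apply: (vl_lerZ (ltW r0)); apply: lub => _ [s [Os sf ->]].
rewrite -[step_int _ s]scale1r -(mulVf (lt0r_neq0 r0)) -scalerA.
apply: vl_lerZ; first by rewrite invr_ge0 ltW.
rewrite -step_int_scale; apply: ubc; exists (step_scale r s); split => // [|x].
  exact: step_in_scale.
by rewrite step_val_scale ler_pM2l.
Qed.

Lemma has_integral_indic D : Omega D -> has_integral \1_D (mu D).
Proof.
move=> OD; have := @has_integral_step [:: (1, D)].
rewrite /step_int big_seq1 scale1r (_ : step_val _ = \1_D) => [|]; last first.
  by apply/funext => x; rewrite /step_val big_seq1 mul1r.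
by apply=> [p|x]; rewrite ?inE ?indicE// => /eqP ->.
Qed.

Hypothesis hA : sigma_dedekind_complete A.

(** The set of lower sums may be uncountable, so sigma-Dedekind completeness is applied to the
    integrals along one approximating sequence. *)
Lemma has_integral_ubound f b : measurable_real Omega f -> (forall x, 0 <= f x) ->
  ubound (lower_sums f) b -> exists a, has_integral f a.
Proof.
move=> mf f0 ub; have [t tf] := approximates_exists mf f0.
have [||a /(approximates_isLub hOmega hmu _ tf) ?] :=
    hA (S := range (fun n => step_int mu (t n))).
- exact: card_image_le.
- split; first by exists (step_int mu (t 0%N)), 0%N.
  exists b => _ [n _ <-]; apply: ub; exists (t n); case: tf => Ot tf _ _.
  split=> //.
  by move=> x; case/andP: (tf n x).
- by exists a.
Qed.

Lemma has_integral_dominated f g b : measurable_real Omega f ->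
  (forall x, 0 <= f x <= g x) -> has_integral g b -> exists a, has_integral f a.
Proof.
move=> mf fg [_ _ [ub _]]; apply: (@has_integral_ubound _ b) => //.
  by move=> x; case/andP: (fg x).
move=> _ [s [Os sf ->]]; apply: ub; exists s; split=> // x.
by rewrite (le_trans (sf x)); case/andP: (fg x).
Qed.

End has_integral_theory.

(** * The integral of signed functions and its linearity on [L1] *)

Lemma funrposBneg_val (T : Type) (R : realDomainType) (f : T -> R) x :
  f^\+ x - f^\- x = f x.
Proof. by rewrite -[in RHS](funrposBneg f). Qed.

Lemma funrposDneg_val (T : Type) (R : realDomainType) (f : T -> R) x :
  f^\+ x + f^\- x = `|f x|.
Proof. by rewrite -[RHS]/((Num.norm \o f) x) -funrposDneg. Qed.

Section I_mu_theory.
Context {R : realType} {X : Type} {Omega : set (set X)} {A : vlAlgType R}.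
Context {mu : set X -> A}.
Hypothesis hOmega : sigma_algebra [set: X] Omega.
Hypothesis hmu : finite_A_measure Omega mu.
Hypothesis hA : sigma_dedekind_complete A.
Implicit Types (f g p q : X -> R) (a b c d : A).
Local Notation has_integral := (@has_integral R X Omega A mu).
Local Notation L1 := (L1 Omega mu).
Local Notation I_mu := (I_mu Omega mu).

(** Any two nonnegative integrable functions with difference f are allowed, not only its positive
    and negative parts, so that sums and products stay in this form. *)
Definition difference_integral f a : Prop := exists p q b c,
  [/\ has_integral p b, has_integral q c, f = (fun x => p x - q x) & a = b - c].

(** The parts of f are dominated by p and q, hence integrable, and integrating p + [f^\-] = [f^\+] +
    q shows that they give the same difference. *)
Lemma difference_integral_parts f a : difference_integral f a ->
  exists b c, [/\ has_integral f^\+ b, has_integral f^\- c & a = b - c].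
Proof.
move=> [p [q [b [c [pb qc fpq ->]]]]].
have [mp p0 _] := pb; have [mq q0 _] := qc.
have fE x : f x = p x - q x by rewrite fpq.
have mf : measurable_real Omega f.
  by rewrite fpq; apply: measurable_realD => //; apply: measurable_realN.
have [||b' fb'] := has_integral_dominated hOmega hmu hA (f := f^\+) _ _ pb.
- exact: measurable_funrpos_real.
- by move=> x; rewrite /funrpos le_max lexx orbT ge_max p0 fE gerBl q0.
have [||c' fc'] := has_integral_dominated hOmega hmu hA (f := f^\-) _ _ qc.
- exact: measurable_funrneg_real.
- by move=> x; rewrite /funrneg le_max lexx orbT ge_max q0 fE opprB gerBl p0.
exists b', c'; split=> //.
have bc : b + c' = b' + c.
  apply: (has_integral_uniq (has_integralD hOmega hmu pb fc')).
  have := has_integralD hOmega hmu fb' qc; congr (has_integral _ _).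
  apply/funext => x; have := funrposBneg_val f x; rewrite fE; lra.
by rewrite -[b](addrK c') bc addrAC addrK.
Qed.

Lemma I_mu_difference f a : difference_integral f a -> L1 f /\ I_mu f = a.
Proof.
move=> /difference_integral_parts[b [c [fb fc ->]]]; split.
  split.
    have [[mp _ _] [mq _ _]] := (fb, fc).
    rewrite -(funrposBneg f); apply: measurable_realD => //.
    exact: measurable_realN.
  exists (b + c); have := has_integralD hOmega hmu fb fc.
  move/(order_integral_has_integral hOmega hmu) => <-; congr order_integral.
  by apply/funext => x /=; rewrite funrposDneg_val.
rewrite /I_mu.
have /= -> := order_integral_has_integral hOmega hmu fb.
by have /= -> := order_integral_has_integral hOmega hmu fc.
Qed.

(** Both parts of f are dominated by its absolute value, hence have integrals, and [I_mu f] is their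
    difference. *)
Lemma L1_difference f : L1 f -> difference_integral f (I_mu f).
Proof.
move=> [mf [a fa]].
have {}fa : has_integral (fun x => `|f x|) a.
  apply: (has_integral_order_integral hOmega hmu) => //.
  rewrite (_ : (fun _ => _) = fun x => f^\+ x + f^\- x).
    apply: measurable_realD => //; first exact: measurable_funrpos_real.
    exact: measurable_funrneg_real.
  by apply/funext => x; rewrite funrposDneg_val.
have fE := funrposDneg_val f.
have p0 x : 0 <= f^\+ x by rewrite /funrpos le_max lexx orbT.
have q0 x : 0 <= f^\- x by rewrite /funrneg le_max lexx orbT.
have [||b fb] := has_integral_dominated hOmega hmu hA (f := f^\+) _ _ fa.
- exact: measurable_funrpos_real.
- by move=> x; rewrite p0 -fE lerDl q0.
have [||c fc] := has_integral_dominated hOmega hmu hA (f := f^\-) _ _ fa.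
- exact: measurable_funrneg_real.
- by move=> x; rewrite q0 -fE lerDr p0.
have fbc : difference_integral f (b - c).
  exists f^\+, f^\-, b, c; split=> //.
  by apply/funext => x; rewrite funrposBneg_val.
by have [_ ->] := I_mu_difference fbc.
Qed.

Lemma difference_integral_has_integral f a : has_integral f a ->
  difference_integral f a.
Proof.
move=> fa; exists f, (fun=> 0), a, 0; split; rewrite ?subr0//.
  exact: has_integral_cst0.
by apply/funext => x; rewrite subr0.
Qed.

Lemma difference_integralD f g a b : difference_integral f a ->
  difference_integral g b -> difference_integral (fun x => f x + g x) (a + b).
Proof.
move=> [p [q [a1 [a2 [pa qa -> ->]]]]] [r [s [b1 [b2 [rb sb -> ->]]]]].
exists (fun x => p x + r x), (fun x => q x + s x), (a1 + b1), (a2 + b2).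
split; rewrite ?opprD 1?addrACA//; try exact: has_integralD.
by apply/funext => x; rewrite opprD addrACA.
Qed.

Lemma difference_integralN f a : difference_integral f a ->
  difference_integral (fun x => - f x) (- a).
Proof.
move=> [p [q [b [c [pb qc -> ->]]]]]; exists q, p, c, b.
by split; rewrite ?opprB//; apply/funext => x; rewrite opprB.
Qed.

Lemma difference_integralZ r f a : difference_integral f a ->
  difference_integral (fun x => r * f x) (r *: a).
Proof.
wlog r0 : r f a / 0 <= r => [hw fa|].
  have [/hw|/ltW r0] := leP 0 r; first exact.
  have := difference_integralN fa.
  move=> /(hw (- r)); rewrite oppr_ge0 => /(_ r0).
  by rewrite scaleNr scalerN opprK; under eq_fun do rewrite mulrNN.
move=> [p [q [b [c [pb qc -> ->]]]]].
exists (fun x => r * p x), (fun x => r * q x), (r *: b), (r *: c).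
split; rewrite ?scalerBr//; try exact: has_integralZ.
by apply/funext => x; rewrite mulrBr.
Qed.

Lemma L1_linear_subspace : linear_subspace L1.
Proof.
split.
  have [] // := @I_mu_difference (fun=> 0) 0.
  exact/difference_integral_has_integral/has_integral_cst0.
move=> r f g /L1_difference fL /L1_difference gL.
have /I_mu_difference[] // := difference_integralD (difference_integralZ r fL) gL.
Qed.

Lemma L1_linear_on : linear_on L1 I_mu.
Proof.
move=> r f g /L1_difference fL /L1_difference gL.
have /I_mu_difference[] // := difference_integralD (difference_integralZ r fL) gL.
Qed.

Lemma I_mu_indic D : Omega D -> I_mu \1_D = mu D.
Proof.
move=> OD; have [] // := @I_mu_difference \1_D (mu D).
exact/difference_integral_has_integral/has_integral_indic.
Qed.

Lemma bounded_measurable_L1 : bounded_measurable Omega `<=` L1.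
Proof.
move=> f [mf [M fM]]; split=> //.
(* Over an empty X the bound M may be negative. The dominating function is the constant [|M|] on X,
   integrable because [mu setT] lies in A. *)
have M0 : 0 <= `|M| by [].
have := has_integral_indic hOmega hmu (salgT hOmega).
move=> /(has_integralZ hOmega hmu M0).
move=> /(has_integral_dominated hOmega hmu hA (f := fun x => `|f x|))[||a fa].
- rewrite (_ : (fun _ => _) = f \max (fun x => - f x)).
    by apply: measurable_real_max => //; apply: measurable_realN.
  by apply/funext => x; rewrite /= maxrN.
- move=> x; rewrite normr_ge0 indicE in_setT mulr1 (le_trans (fM x))//.
  exact: ler_norm.
by exists a; apply: (order_integral_has_integral hOmega hmu).
Qed.

Lemma indic_bounded_measurable D : Omega D ->
  bounded_measurable Omega (\1_D : X -> R).
Proof.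
move=> OD; split; first exact: measurable_real_indic.
by exists 1 => x; rewrite indicE; case: (_ \in _); rewrite ?normr1 ?normr0.
Qed.

Lemma bounded_measurable_linear_subspace :
  linear_subspace (bounded_measurable (R := R) Omega).
Proof.
split.
  by split; [exact: measurable_real_cst|exists 0 => x; rewrite normr0].
move=> r f g [mf [M fM]] [mg [N gN]]; split.
  by apply: measurable_realD => //; apply: measurable_realZ.
exists (`|r| * M + N) => x; rewrite (le_trans (ler_normD _ _))// lerD//.
by rewrite normrM ler_wpM2l.
Qed.

Lemma bounded_measurable_function_lattice :
  function_lattice (bounded_measurable (R := R) Omega).
Proof.
split; first exact: bounded_measurable_linear_subspace.
move=> f g [mf [M fM]] [mg [N gN]].
split; split; [exact: measurable_real_min| |exact: measurable_real_max|];
  exists (Num.max M N) => x; rewrite le_max /=.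
- by rewrite minEle; case: ifP; rewrite ?fM ?gN ?orbT.
- by rewrite maxEle; case: ifP; rewrite ?fM ?gN ?orbT.
Qed.

Lemma bounded_measurable_function_algebra :
  function_algebra (bounded_measurable (R := R) Omega).
Proof.
split; first exact: bounded_measurable_linear_subspace.
move=> f g [mf [M fM]] [mg [N gN]]; split; first exact: measurable_realM.
by exists (M * N) => x; rewrite normrM ler_pM.
Qed.

End I_mu_theory.

(** * Bilinearity and monotonicity of the product *)

Section vl_algebra.
Context {R : realType} {A : vlAlgType R}.
Implicit Types x y z t : A.

Lemma vla_mul0 x : (x * 0)%g = 0.
Proof. by apply: (addIr (x * 0)%g); rewrite -vla_mulDr !add0r. Qed.

Lemma vla_0mul x : (0 * x)%g = 0.
Proof. by apply: (addIr (0 * x)%g); rewrite -vla_mulDl !add0r. Qed.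

Lemma vla_mulrN x y : (x * - y)%g = - (x * y)%g.
Proof. by apply: (addIr (x * y)%g); rewrite -vla_mulDr !addNr vla_mul0. Qed.

Lemma vla_mulNr x y : (- x * y)%g = - (x * y)%g.
Proof. by apply: (addIr (x * y)%g); rewrite -vla_mulDl !addNr vla_0mul. Qed.

Lemma vla_lerM2l z x y : 0 <= z -> x <= y -> (z * x <= z * y)%g.
Proof.
move=> z0 xy; rewrite -vl_subr_ge0 -vla_mulrN -vla_mulDr vla_mul_ge0//.
by rewrite vl_subr_ge0.
Qed.

Lemma vla_lerM2r z x y : 0 <= z -> x <= y -> (x * z <= y * z)%g.
Proof.
move=> z0 xy; rewrite -vl_subr_ge0 -vla_mulNr -vla_mulDl vla_mul_ge0//.
by rewrite vl_subr_ge0.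
Qed.

Lemma vla_lerM x y z t : 0 <= x -> 0 <= t -> x <= y -> z <= t ->
  (x * z <= y * t)%g.
Proof.
by move=> x0 t0 xy zt; apply: (le_trans (vla_lerM2l x0 zt)); apply: vla_lerM2r.
Qed.

Lemma vla_mul_suml I (r : seq I) (F : I -> A) y :
  ((\sum_(i <- r) F i)%R * y)%g = \sum_(i <- r) (F i * y)%g.
Proof.
exact: (big_morph (fun x => x * y)%g (fun u v => vla_mulDl u v y) (vla_0mul y)).
Qed.

Lemma vla_mul_sumr I (r : seq I) (F : I -> A) y :
  (y * (\sum_(i <- r) F i)%R)%g = \sum_(i <- r) (y * F i)%g.
Proof. exact: (big_morph (fun x => y * x)%g (vla_mulDr y) (vla_mul0 y)). Qed.

End vl_algebra.

(** * Meets, joins and vector lattice homomorphisms *)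

Section meets_joins.
Context {R : realType} {X : Type} {Omega : set (set X)} {A : vlAlgType R}.
Context {mu : set X -> A}.
Hypothesis hOmega : sigma_algebra [set: X] Omega.
Hypothesis hmu : finite_A_measure Omega mu.

Lemma A_measure_setUI D E : Omega D -> Omega E ->
  mu (D `|` E) + mu (D `&` E) = mu D + mu E.
Proof.
move=> OD OE; have ODE := salgU hOmega OD OE.
rewrite (A_measure_split hOmega hmu ODE OE) [(_ `|` _) `&` _]setIC setKU.
rewrite setDUl setDv setU0.
rewrite -addrA [X in mu E + X]addrC -(A_measure_split hOmega hmu OD OE).
exact: addrC.
Qed.

(** The measures of union and intersection have the same sum as the join and meet of [mu D] and
    [mu E], namely [mu D + mu E]; equality in one place forces it in the other. *)
Lemma preserves_joins_meets :
  preserves_joins Omega mu <-> preserves_meets Omega mu.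
Proof.
split=> hmj D E OD OE; have := A_measure_setUI OD OE; rewrite (hmj D E)//.
  rewrite vjoinE -addrA -[RHS]addr0 => /addrI/eqP.
  by rewrite addrC subr_eq0 => /eqP.
by rewrite vjoinE => <-; rewrite addrK.
Qed.

(** Translation takes the common summand [mu (D]&[E)] out of the meet, which leaves the meet of the
    measures of two disjoint differences. *)
Lemma preserves_meets_disjoint :
  (forall D E, Omega D -> Omega E -> D `&` E = set0 ->
     vmeet (mu D) (mu E) <= 0) ->
  preserves_meets Omega mu.
Proof.
move=> disj D E OD OE.
rewrite (A_measure_split hOmega hmu OD OE) (A_measure_split hOmega hmu OE OD).
rewrite [E `&` D]setIC vmeetDl -[LHS]addr0; congr +%R.
have ODE := salgD hOmega OD OE; have OED := salgD hOmega OE OD.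
apply/eqP; rewrite eq_le vl_lexI !(A_measure_ge0 hmu)//=.
apply: disj => //; apply/seteqP; split => // x [[]] //.
by move=> _ nEx [].
Qed.

(** Where p vanishes s is at most 0, so s lies below K times the indicator of the support of p. *)
Lemma step_int_le_support p s K : measurable_real Omega p ->
  step_in Omega s -> (forall x, step_val s x <= p x) ->
  (forall x, `|step_val s x| <= K) ->
  step_int mu s <= K *: mu (p @^-1` [set~ 0]).
Proof.
move=> mp Os sp sK.
have -> : K *: mu (p @^-1` [set~ 0]) = step_int mu [:: (K, p @^-1` [set~ 0])].
  by rewrite /step_int big_seq1.
apply: (step_int_le hOmega hmu) => // [q|x].
  by rewrite inE => /eqP ->; apply: mp; apply: measurableC.
rewrite [leRHS]big_seq1 /= indicE; have [px0|px0] := pselect (p x = 0).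
  by rewrite memNset; [rewrite mulr0 -[leRHS]px0|move=> /(_ px0)].
by rewrite mem_set// mulr1 (le_trans (ler_norm _)).
Qed.

Lemma has_integral_disjoint p q a b : preserves_meets Omega mu ->
  has_integral (Omega := Omega) (mu := mu) p a ->
  has_integral (Omega := Omega) (mu := mu) q b ->
  (forall x, p x = 0 \/ q x = 0) -> vmeet a b = 0.
Proof.
move=> meets pa qb pq0.
have [mp p0 fp] := pa; have [mq q0 fq] := qb.
apply/eqP; rewrite eq_le vl_lexI (has_integral_ge0 pa) (has_integral_ge0 qb) !andbT.
apply: (isLub_vmeet_le fp) => _ [s [Os sp ->]].
rewrite vmeetC; apply: (isLub_vmeet_le fq) => _ [t [Ot tq ->]].
have [M M0 sM] := step_val_bounded s; have [N N0 tN] := step_val_bounded t.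
have K0 : 0 < M + N by rewrite addr_gt0.
have Ki0 : 0 <= (M + N)^-1 by rewrite invr_ge0 ltW.
(* Division by the common bound M + N puts the meet below the measures of the supports of p and q.
   These sets are disjoint, so the meet of their measures is [mu set0]. *)
have : (M + N)^-1 *: vmeet (step_int mu t) (step_int mu s) <= 0.
  have [Op Oq] : Omega (p @^-1` [set~ 0]) /\ Omega (q @^-1` [set~ 0]).
    by split; [apply: mp|apply: mq]; apply: measurableC.
  rewrite -(A_measure0 hmu) (_ : set0 = p @^-1` [set~ 0] `&` q @^-1` [set~ 0]).
    have sN x : `|step_val s x| <= M + N.
      by rewrite (le_trans (sM x))// lerDl ltW.
    have tM x : `|step_val t x| <= M + N.
      by rewrite (le_trans (tN x))// lerDr ltW.
    rewrite meets// vl_lexI; apply/andP; split.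
      have := vl_lerZ Ki0 (step_int_le_support mp Os sp sN).
      rewrite scalerA mulVf ?gt_eqF// scale1r; apply: le_trans.
      by apply: vl_lerZ => //; apply: vmeet_ler.
    have := vl_lerZ Ki0 (step_int_le_support mq Ot tq tM).
    rewrite scalerA mulVf ?gt_eqF// scale1r; apply: le_trans.
    by apply: vl_lerZ => //; apply: vmeet_lel.
  by apply/seteqP; split => // x [/= px qx]; case: (pq0 x).
move=> /(vl_lerZ (ltW K0)); rewrite scalerA divff ?gt_eqF// scale1r.
by rewrite scaler0.
Qed.

Hypothesis hA : sigma_dedekind_complete A.

Lemma L1_vector_lattice_hom : preserves_meets Omega mu ->
  vector_lattice_hom (L1 Omega mu) (I_mu Omega mu).
Proof.
move=> meets.
have main f g : L1 Omega mu f -> L1 Omega mu g ->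
    (L1 Omega mu (f \min g) /\
      I_mu Omega mu (f \min g) = vmeet (I_mu Omega mu f) (I_mu Omega mu g)) /\
    (L1 Omega mu (f \max g) /\
      I_mu Omega mu (f \max g) = vjoin (I_mu Omega mu f) (I_mu Omega mu g)).
  move=> /(L1_difference hOmega hmu hA) fa /(L1_difference hOmega hmu hA) gb.
  move: (I_mu _ _ f) (I_mu _ _ g) fa gb => a b fa gb.
  have := difference_integralD hOmega hmu fa (difference_integralN gb).
  move=> /(difference_integral_parts hOmega hmu hA)[c [d [hc hd abE]]].
  (* With h = f - g, the minimum of f and g is g - [h^\-] and the maximum is g + [h^\+], so
     everything follows once c and d, the integrals of the parts of h, are disjoint. *)
  set h := fun x => f x - g x in hc hd.
  have cd0 : vmeet c d = 0.
    apply: (has_integral_disjoint meets hc hd) => x.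
    rewrite /funrpos /funrneg; have [h0|h0] := leP 0 (h x); [right|by left].
    by apply/max_idPr; rewrite oppr_le0.
  have aE : a = b + (c - d) by rewrite -abE addrC subrK.
  (* Translating by b and then by -d turns the meet of b + c - d and b into b - d plus the meet of c
     and d. *)
  have meetE : vmeet a b = b - d.
    rewrite aE -[X in vmeet _ X]addr0 vmeetDl -(subrr d) vmeetDr cd0.
    by rewrite add0r.
  have joinE : vjoin a b = b + c.
    by rewrite vjoinE meetE aE opprB addrACA subrr addr0 -addrA subrK.
  rewrite meetE joinE; split; apply: (I_mu_difference hOmega hmu hA).
    rewrite (_ : _ \min _ = fun x => g x - h^\- x).
      apply: difference_integralD => //.
      exact/difference_integralN/difference_integral_has_integral.
    apply/funext => x; rewrite /funrneg /h/= opprB.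
    case: (leP (g x) (f x)) => fg; first by rewrite max_r ?subr_le0//; lra.
    by rewrite max_l ?subr_ge0 ?ltW//; lra.
  rewrite (_ : _ \max _ = fun x => g x + h^\+ x).
    apply: difference_integralD => //.
    exact/difference_integral_has_integral.
  apply/funext => x; rewrite /funrpos /h /=.
  case: (leP (g x) (f x)) => fg; first by rewrite max_l ?subr_ge0//; lra.
  by rewrite max_r ?subr_le0 ?ltW//; lra.
split; last 2 first.
- exact: L1_linear_on.
- by move=> f g fL gL; have [[_ +] [_ +]] := main f g fL gL.
split; first exact: L1_linear_subspace.
by move=> f g fL gL; have [[+ _] [+ _]] := main f g fL gL.
Qed.

End meets_joins.

(** * Spectral measures, algebra homomorphisms and the passage to meets *)

Section spectral.
Context {R : realType} {X : Type} {Omega : set (set X)} {A : vlAlgType R}.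
Context {mu : set X -> A}.
Hypothesis hOmega : sigma_algebra [set: X] Omega.
Hypothesis hmu : finite_A_measure Omega mu.
Local Notation has_integral := (@has_integral R X Omega A mu).
Local Notation L1 := (L1 Omega mu).
Local Notation I_mu := (I_mu Omega mu).

Lemma step_int_mul s t : spectral Omega mu ->
  step_in Omega s -> step_in Omega t ->
  step_int mu (step_mul s t) = (step_int mu s * step_int mu t)%g.
Proof.
move=> mult Os Ot; rewrite /step_int big_allpairs_dep vla_mul_suml.
rewrite big_seq [RHS]big_seq; apply: eq_bigr => p /Os Op.
rewrite vla_mul_sumr big_seq [RHS]big_seq; apply: eq_bigr => q /Ot Oq /=.
by rewrite mult// -scalerA vla_scaleAr vla_scaleAl.
Qed.

Hypothesis hmul : sigma_monotone_continuous_mul A.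

Lemma has_integralM f g a b : spectral Omega mu ->
  has_integral f a -> has_integral g b ->
  has_integral (fun x => f x * g x) (a * b)%g.
Proof.
move=> mult fa gb; have [mf f0 lubf] := fa; have [mg g0 lubg] := gb.
have [t tf] := approximates_exists mf f0.
have [u ug] := approximates_exists mg g0.
have [[Ot tfx _ _] [Ou ugx _ _]] := (tf, ug).
have t0 n := approximates_int_ge0 hOmega hmu n tf.
have u0 n := approximates_int_ge0 hOmega hmu n ug.
split; [exact: measurable_realM|by move=> x; rewrite mulr_ge0|split].
  apply: (approximates_ubound hOmega hmu (approximatesM hOmega tf ug)) => n.
  rewrite step_int_mul// vla_lerM ?(has_integral_ge0 gb)//.
    exact: approximates_int_le fa tf.
  exact: approximates_int_le gb ug.
have inct : increases_to (fun n => step_int mu (t n)) a.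
  split; first exact: approximates_nd tf.
  exact/(approximates_isLub hOmega hmu _ tf).
have incu : increases_to (fun n => step_int mu (u n)) b.
  split; first exact: approximates_nd ug.
  exact/(approximates_isLub hOmega hmu _ ug).
move=> c ubc.
(* Monotone continuity is used in each factor in turn: b is replaced by the integrals of the u n,
   then, with n fixed, a by those of the t m. *)
have [[_ [_ lub]] _] := hmul u0 (has_integral_ge0 gb) incu (has_integral_ge0 fa).
apply: lub => _ [n _ <-].
have [_ [_ [_]]] := hmul t0 (has_integral_ge0 fa) inct (u0 n).
apply => _ [m _ <-].
rewrite -step_int_mul//; apply: ubc; exists (step_mul (t m) (u n)).
split => // [|x]; first exact: step_in_mul.
rewrite step_val_mul; have /andP[? ?] := tfx m x; have /andP[? ?] := ugx n x.
by rewrite ler_pM.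
Qed.

Lemma difference_integralM f g a b : spectral Omega mu ->
  difference_integral (Omega := Omega) (mu := mu) f a ->
  difference_integral (Omega := Omega) (mu := mu) g b ->
  difference_integral (Omega := Omega) (mu := mu) (fun x => f x * g x) (a * b)%g.
Proof.
move=> mult [p [q [a1 [a2 [pa qa -> ->]]]]] [r [s [b1 [b2 [rb sb -> ->]]]]].
exists (fun x => p x * r x + q x * s x), (fun x => p x * s x + q x * r x).
exists ((a1 * b1)%g + (a2 * b2)%g), ((a1 * b2)%g + (a2 * b1)%g); split.
- by apply: has_integralD => //; apply: has_integralM.
- by apply: has_integralD => //; apply: has_integralM.
- by apply/funext => x; ring.
- rewrite vla_mulDl !vla_mulDr !vla_mulNr !vla_mulrN opprK.
  by rewrite [- _ + (a2 * b2)%g]addrC addrACA -opprD.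
Qed.

Hypothesis hA : sigma_dedekind_complete A.

Lemma L1_algebra_hom : spectral Omega mu -> algebra_hom L1 I_mu.
Proof.
move=> mult.
have main f g : L1 f -> L1 g ->
    L1 (f \* g) /\ I_mu (f \* g) = (I_mu f * I_mu g)%g.
  move=> /(L1_difference hOmega hmu hA) fa /(L1_difference hOmega hmu hA) gb.
  exact/(I_mu_difference hOmega hmu hA)/difference_integralM.
split; [|exact: L1_linear_on|by move=> f g fL gL; case: (main f g fL gL)].
split; first exact: L1_linear_subspace.
by move=> f g fL gL; case: (main f g fL gL).
Qed.

(** With a and b the two measures, idempotence of a, b and a + b leaves ab + ba = 0, and both
    summands are positive. *)
Lemma A_measure_mul_disjoint D E : (forall D, Omega D -> mu D * mu D = mu D)%g ->
  Omega D -> Omega E -> D `&` E = set0 -> (mu D * mu E)%g = 0.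
Proof.
move=> idem OD OE DE0; have D0 := A_measure_ge0 hmu OD.
have E0 := A_measure_ge0 hmu OE.
have := idem _ (salgU hOmega OD OE).
rewrite (A_measureU hOmega hmu OD OE DE0) vla_mulDl !vla_mulDr !idem//.
rewrite -addrA => /addrI; rewrite addrA -[RHS]add0r => /addIr DE.
apply/eqP; rewrite eq_le vla_mul_ge0// andbT -DE.
by rewrite -[leLHS]addr0 vl_lerD2l vla_mul_ge0.
Qed.

(** Both D and E are split along their intersection. In the expanded product every term but the
    square of [mu (D]&[E)] comes from disjoint sets and vanishes. *)
Lemma idempotent_commuting_spectral :
  idempotent_commuting Omega mu -> spectral Omega mu.
Proof.
move=> [idem comm] D E OD OE.
have ODE := salgI hOmega OD OE; have ODE' := salgD hOmega OD OE.
have OED' := salgD hOmega OE OD.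
rewrite (A_measure_split hOmega hmu OD OE) (A_measure_split hOmega hmu OE OD).
rewrite [E `&` D]setIC vla_mulDl !vla_mulDr idem//.
rewrite !(A_measure_mul_disjoint idem) ?addr0//;
  by apply/seteqP; split => // x [[? ?] [? ?]].
Qed.

Lemma spectral_preserves_meets : spectral Omega mu ->
  (exists e : A, [/\ 0 <= e, is_identity e & mu [set: X] <= e]) \/
    is_semiprime A ->
  preserves_meets Omega mu.
Proof.
move=> mult hA'; apply: (preserves_meets_disjoint hOmega hmu) => D E OD OE DE0.
have ab0 : (mu D * mu E)%g = 0 by rewrite -mult// DE0 (A_measure0 hmu).
have a0 := A_measure_ge0 hmu OD; have b0 := A_measure_ge0 hmu OE.
have aa : (mu D * mu D)%g = mu D by rewrite -mult// setIid.
have ae : mu D <= mu setT by apply: (le_A_measure hOmega hmu) => //; exact: salgT.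
move: (mu D) (mu E) a0 b0 ab0 aa ae => a b a0 b0 ab0 aa ae.
have xa := vmeet_lel a b; have xb := vmeet_ler a b.
have x0 : 0 <= vmeet a b by rewrite vl_lexI a0.
move: (vmeet a b) xa xb x0 => x xa xb x0.
case: hA' => [[e [e0 eid /(le_trans ae) {}ae]]|sp].
  have ea0 : 0 <= e - a by rewrite vl_subr_ge0.
  have [<- _] := eid x; rewrite -(subrK a e) vla_mulDl -[leRHS]add0r.
  apply: vl_lerD; last by rewrite -ab0 vla_lerM2l.
  apply: (le_trans (vla_lerM2l ea0 xa)).
  by rewrite vla_mulDl vla_mulNr aa (eid a).1 subrr.
suff -> : x = 0 by [].
(* The exponent in [nilpotent_elt] is shifted by one, so the witness 1 stands for the square of
   x. *)
apply: sp; exists 1%N => /=; apply/eqP; rewrite eq_le vla_mul_ge0// andbT.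
by rewrite -ab0 vla_lerM.
Qed.

End spectral.

(** * The two cycles of equivalences and the implication between them *)

Theorem theorem4p6 (R : realType) (X : Type) (Omega : set (set X))
    (A : vlAlgType R) (mu : set X -> A)
    (hOmega : sigma_algebra [set: X] Omega)
    (hA : sigma_dedekind_complete A)
    (hmul : sigma_monotone_continuous_mul A)
    (hmu : finite_A_measure Omega mu) :
  let P1 := vector_lattice_hom (L1 Omega mu) (I_mu Omega mu) in
  let P2 := vector_lattice_hom (bounded_measurable Omega) (I_mu Omega mu) in
  let P3 := preserves_meets Omega mu in
  let P4 := preserves_joins Omega mu in
  let P5 := function_algebra (L1 Omega mu) /\
            algebra_hom (L1 Omega mu) (I_mu Omega mu) in
  let P6 := algebra_hom (bounded_measurable Omega) (I_mu Omega mu) in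
  let P7 := spectral Omega mu in
  let P8 := idempotent_commuting Omega mu in
  [/\ [<-> P1; P2; P3; P4],
      [<-> P5; P6; P7; P8] &
      (exists e : A, [/\ 0 <= e, is_identity e & mu [set: X] <= e]) \/
      (is_f_algebra A /\ is_semiprime A) ->
      (P5 \/ P6 \/ P7 \/ P8) -> [/\ P1, P2, P3 & P4]].
Proof.
move=> P1 P2 P3 P4 P5 P6 P7 P8.
have BL1 := bounded_measurable_L1 hOmega hmu hA.
have indicB := @indic_bounded_measurable R X Omega hOmega.
have P12 : P1 -> P2.
  move=> [_ lin meet]; split; first exact: bounded_measurable_function_lattice.
    by move=> r f g /BL1 fL /BL1 gL; apply: lin.
  by move=> f g /BL1 fL /BL1 gL; apply: meet.
have P23 : P2 -> P3.
  move=> [_ _ meet] D E OD OE.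
  have [+ _] := meet _ _ (indicB _ OD) (indicB _ OE).
  rewrite !(I_mu_indic hOmega hmu hA)// => <-.
  rewrite -(I_mu_indic hOmega hmu hA (salgI hOmega OD OE)); congr I_mu.
  apply/funext => x; rewrite /= !indicE in_setI minEle ler_nat.
  by case: (x \in D); case: (x \in E).
have P34 : P3 -> P4 by move/(preserves_joins_meets hOmega hmu).
have P41 : P4 -> P1.
  by move/(preserves_joins_meets hOmega hmu)/(L1_vector_lattice_hom hOmega hmu hA).
have P56 : P5 -> P6.
  move=> [_ [_ lin mult]].
  split; first exact: bounded_measurable_function_algebra.
    by move=> r f g /BL1 fL /BL1 gL; apply: lin.
  by move=> f g /BL1 fL /BL1 gL; apply: mult.
have P67 : P6 -> P7.
  move=> [_ _ mult] D E OD OE.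
  have := mult _ _ (indicB _ OD) (indicB _ OE).
  by rewrite -indicI !(I_mu_indic hOmega hmu hA)//; apply: salgI.
have P78 : P7 -> P8.
  move=> mult; split=> [D OD|D E OD OE]; first by rewrite -mult// setIid.
  by rewrite -!mult// setIC.
have P87 : P8 -> P7 by apply: (idempotent_commuting_spectral hOmega hmu).
have P75 : P7 -> P5.
  by move=> /(L1_algebra_hom hOmega hmu hmul hA) hom; split=> //; case: hom.
split; [by tfae|by tfae => // /P87|].
move=> ab P5678.
have p7 : P7 by case: P5678 => [/P56/P67|[/P67|[|/P87]]].
have p3 : P3.
  apply: (spectral_preserves_meets hOmega hmu p7).
  by case: ab => [|[_]]; [left|right].
by split; [exact/P41/P34|exact/P12/P41/P34| |exact: P34].
Qed.
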